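(* Let $\mathcal{U}_n$ be the set of isomorphism classes of unit interval orders with $n$ elements and $\mathcal{P}_n$ the set of unit interval positroids on $[2n]$. The map $\mathcal{U}_n\to\mathcal{P}_n$ sending (the class of) a unit interval order $P$ to the unit interval positroid induced by $P$ is a bijection.
   Context: A poset $P$ is a unit interval order if there is a bijection $i\mapsto[q_i,q_i+1]$ to closed unit intervals of $\mathbb{R}$ with $i<_P j$ iff $q_i+1<q_j$. For a poset labeled bijectively by $[n]$, the altitude of $i$ is $\alpha(i)=|\{j: j\le_P i\}|-|\{j: i\le_P j\}|$; the labeling is canonical if $\alpha(i)<\alpha(j)$ implies $i<j$. The antiadjacency matrix is the $n\times n$ $0/1$ matrix $(a_{i,j})$ with $a_{i,j}=0$ iff $i<_P j$; isomorphic canonically labeled unit interval orders have the same antiadjacency matrix. For an $n\times n$ matrix $A=(a_{i,j})$, $\psi(A)$ is the $n\times 2n$ matrix whose first $n$ columns form $I_n$ and whose column $n+j$ has entry $(-1)^{n-i}a_{n+1-i,j}$ in row $i$. The unit interval positroid induced by $P$ is the matroid on $[2n]$ whose bases are the $n$-subsets indexing linearly independent columns of $\psi(A)$, where $A$ is the antiadjacency matrix of $P$ under a canonical labeling; $\mathcal{P}_n$ is the set of all matroids arising this way from unit interval orders on $n$ elements. *)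

(* Defs.v *)
From HB Require Import structures.
From mathcomp Require Import all_boot all_order all_algebra.
From mathcomp Require Import all_classical all_reals.

Set Implicit Arguments.
Unset Strict Implicit.
Unset Printing Implicit Defensive.

Import Order.TTheory GRing.Theory Num.Theory.
Local Open Scope classical_set_scope.
Local Open Scope ring_scope.

Section Poset.
Variables (d : Order.disp_t) (P : finPOrderType d).

(* Injectivity of the interval map is its bijectivity onto the set of intervals
   it takes as values. *)
Definition unit_interval_order (R : realType) : Prop :=
  exists q : P -> R,
    injective (fun x => `[q x, q x + 1]%classic) /\
    forall x y : P, (x < y)%O <-> q x + 1 < q y.

Definition altitude (x : P) : int :=
  #|[set y : P | (y <= x)%O]%SET|%:Z - #|[set y : P | (x <= y)%O]%SET|%:Z.

(* A labeling is given by the function [ell] sending a label to the element that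
   carries it; the labels 1, ..., n are shifted to 0, ..., n - 1. *)
Definition canonical_labeling (n : nat) (ell : 'I_n -> P) : Prop :=
  bijective ell /\
  forall i j : 'I_n, altitude (ell i) < altitude (ell j) -> (i < j)%N.

Definition antiadjacency (R : realType) (n : nat) (ell : 'I_n -> P) : 'M[R]_n :=
  \matrix_(i, j) (if (ell i < ell j)%O then 0 else 1).

End Poset.

(* With indices starting at 0, the sign (-1)^(n-i) becomes (-1)^(n-(i+1)), and
   the row n+1-i becomes [rev_ord i]. *)
Definition psi (R : realType) (n : nat) (A : 'M[R]_n) : 'M[R]_(n, n + n) :=
  row_mx 1%:M (\matrix_(i, j) ((-1) ^+ (n - i.+1) * A (rev_ord i) j)).

Record matroid (T : finType) := Matroid {
  bases : {set {set T}};
  bases_nonempty : bases != finset.set0;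
  bases_exchange :
    [forall B1 in bases, forall B2 in bases, forall x in B1 :\: B2,
       exists y in B2 :\: B1, (y |: (B1 :\ x))%SET \in bases] }.

Section IsoClass.
Variable n : nat.

Record ord_poset := OrdPoset {
  ord_poset_le : rel 'I_n;
  ord_poset_refl : reflexive ord_poset_le;
  ord_poset_anti : antisymmetric ord_poset_le;
  ord_poset_trans : transitive ord_poset_le }.

Definition ord_poset_sort (P : ord_poset) : Type := 'I_n.

Coercion ord_poset_sort : ord_poset >-> Sortclass.

HB.instance Definition _ (P : ord_poset) :=
  Finite.copy (ord_poset_sort P) 'I_n.

HB.instance Definition _ (P : ord_poset) :=
  Order.Le_isPOrder.Build Order.default_display (ord_poset_sort P)
    (@ord_poset_refl P) (@ord_poset_anti P) (@ord_poset_trans P).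

Definition isomorphic d (P : finPOrderType d) d' (Q : finPOrderType d') : Prop :=
  exists f : P -> Q, bijective f /\ {mono f : x y / (x <= y)%O}.

(* All finite posets together are too large for a [set].  The isomorphism class
   of a poset with [n] elements is cut down to its members with carrier ['I_n],
   which determine it since every poset with [n] elements has an isomorphic copy
   on ['I_n]. *)
Definition iso_class d (P : finPOrderType d) : set ord_poset :=
  [set Q : ord_poset | isomorphic P Q].

End IsoClass.

Arguments iso_class n {d} P.

Section Positroid.
Variables (R : realType) (n : nat).

Definition unit_interval_classes : set (set (ord_poset n)) :=
  [set c | exists (d : Order.disp_t) (P : finPOrderType d),
     [/\ #|P| = n, unit_interval_order P R & c = iso_class n P]].

(* [free] is applied to the family of columns with repetitions, so that two
   equal columns with distinct indices are linearly dependent. *)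
Definition induced_positroid d (P : finPOrderType d)
    (M : matroid 'I_(n + n)) : Prop :=
  exists ell : 'I_n -> P, canonical_labeling ell /\
    forall B : {set 'I_(n + n)},
      B \in bases M <->
      #|B| = n /\ free [seq col j (psi (antiadjacency R ell)) | j <- enum B].

Definition unit_interval_positroids : set (matroid 'I_(n + n)) :=
  [set M | exists (d : Order.disp_t) (P : finPOrderType d),
     [/\ #|P| = n, unit_interval_order P R & induced_positroid P M]].

End Positroid.

Arguments unit_interval_classes R n : clear implicits.
Arguments unit_interval_positroids R n : clear implicits.

(* Main.v *)
Require Import Defs.
From HB Require Import structures.
From mathcomp Require Import all_boot all_order all_algebra.
From mathcomp Require Import all_classical all_reals.
From mathcomp Require Import zify.

Set Implicit Arguments.
Unset Strict Implicit.
Unset Printing Implicit Defensive.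

Import Order.TTheory GRing.Theory Num.Theory.
Local Open Scope ring_scope.

(* In a unit interval order two elements of equal altitude have the same strict
   down-set and the same strict up-set, so the antiadjacency matrix A does not
   depend on the canonical labeling, nor on the poset within its isomorphism
   class: the map is well defined.  Conversely, replacing one unit vector of the
   identity block of psi(A) by a column of the other block gives a basis exactly
   when one prescribed entry of A is nonzero.  The positroid thus determines the
   0/1 matrix A, hence the order, which gives injectivity. *)

(** * Matroids of vector configurations *)

Lemma matroid_inj (T : finType) : injective (@bases T).
Proof.
case=> b1 n1 e1 [b2 n2 e2] /= eb; move: n1 e1 n2 e2; rewrite eb => *.
by congr Matroid; exact: bool_irrelevance.
Qed.

Section VectorMatroid.
Variables (K : fieldType) (V : vectType K) (T : finType) (v : T -> V).

Lemma free_setU1 (B : {set T}) (y : T) : y \notin B ->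
  free [seq v j | j <- enum (y |: B)%SET] =
  (v y \notin <<[seq v j | j <- enum B]>>%VS) && free [seq v j | j <- enum B].
Proof.
move=> yB; rewrite -free_cons -map_cons; apply/perm_free/perm_map/uniq_perm.
- exact: enum_uniq.
- by rewrite /= enum_uniq mem_enum yB.
- by move=> z; rewrite inE !mem_enum !inE.
Qed.

Lemma free_setD1 (B : {set T}) (x : T) : x \in B ->
  free [seq v j | j <- enum B] -> free [seq v j | j <- enum (B :\ x)%SET].
Proof.
move=> xB; rewrite -[in X in X -> _](finset.setD1K xB).
by rewrite free_setU1 ?finset.setD11// => /andP[].
Qed.

(** If each vector of [B2] outside [B1] lay in the span of [B1] without [x], all of [B2] would, and
    this span has dimension [#|B2| - 1]. *)
Lemma vector_exchange (B1 B2 : {set T}) (x : T) :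
    #|B1| = #|B2| -> free [seq v j | j <- enum B1] ->
    free [seq v j | j <- enum B2] -> x \in (B1 :\: B2)%SET ->
  exists2 y, y \in (B2 :\: B1)%SET &
    free [seq v j | j <- enum (y |: (B1 :\ x))%SET].
Proof.
move=> cB f1 f2; rewrite inE => /andP[xB2 xB1].
have f1x := free_setD1 xB1 f1.
have [/existsP[y /andP[yB yU]]|none] := boolP [exists y in (B2 :\: B1)%SET,
    v y \notin <<[seq v j | j <- enum (B1 :\ x)%SET]>>%VS].
  exists y => //; rewrite free_setU1 ?yU //.
  by move: yB; rewrite !inE => /andP[/negPf-> _]; rewrite andbF.
have sub : (<<[seq v j | j <- enum B2]>> <=
            <<[seq v j | j <- enum (B1 :\ x)%SET]>>)%VS.
  apply/span_subvP => w /mapP[y yB2 ->] {w}; rewrite mem_enum in yB2.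
  have [yB1|yB1] := boolP (y \in B1).
    apply/memv_span/map_f; rewrite mem_enum !inE yB1 andbT.
    by apply: contraNneq xB2 => <-.
  move: none; rewrite negb_exists => /forallP/(_ y).
  by rewrite inE yB1 yB2 /= negbK.
have := dimvS sub; move: f2 f1x; rewrite !/(free _) => /eqP-> /eqP->.
by rewrite !size_map -!cardE -cB (cardsD1 x B1) xB1 ltnn.
Qed.

(** [B0] shows that the set of bases is nonempty; [vector_exchange] gives the exchange axiom. *)
Lemma vector_matroid (n : nat) (B0 : {set T}) :
    #|B0| = n -> free [seq v j | j <- enum B0] ->
  exists M : matroid T, forall B : {set T},
    B \in bases M <-> #|B| = n /\ free [seq v j | j <- enum B].
Proof.
move=> c0 f0.
pose b := [set B : {set T} | (#|B| == n) && free [seq v j | j <- enum B]]%SET.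
have bP B : B \in b <-> #|B| = n /\ free [seq v j | j <- enum B].
  by rewrite inE; split=> [/andP[/eqP]|[/eqP-> ->]].
have b0 : b != finset.set0 by apply/set0Pn; exists B0; apply/bP.
suff bx : [forall B1 in b, forall B2 in b, forall x in B1 :\: B2,
    exists y in B2 :\: B1, (y |: (B1 :\ x))%SET \in b]%SET.
  by exists (Matroid b0 bx).
apply/forall_inP => B1 /bP[c1 f1]; apply/forall_inP => B2 /bP[c2 f2].
apply/forall_inP => x xB; have [|y yB fy] := vector_exchange _ f1 f2 xB.
  by rewrite c1 c2.
apply/exists_inP; exists y => //; apply/bP; split => //.
move: xB yB; rewrite !inE => /andP[_ xB1] /andP[yB1 _].
by rewrite cardsU1 !inE (negPf yB1) andbF -c1 (cardsD1 x B1) xB1.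
Qed.

End VectorMatroid.

(** * Columns and bases of [psi A] *)

Section Psi.
Variables (R : realType) (n : nat) (A : 'M[R]_n).

Let v (j : 'I_(n + n)) : 'cV[R]_n := col j (psi A).
(** Indices of the identity block: a basis whatever [A] is. *)
Let I0 : {set 'I_(n + n)} := [set lshift n k | k in 'I_n]%SET.

Lemma col_psi_lshift k : v (lshift n k) = delta_mx k 0.
Proof. by apply/colP => i; rewrite !mxE (unsplitK (inl _ k)) !mxE eqxx andbT. Qed.

Lemma col_psi_rshift i j :
  v (rshift n j) i 0 = (-1) ^+ (n - i.+1) * A (rev_ord i) j.
Proof. by rewrite !mxE (unsplitK (inr _ j)) !mxE. Qed.

Lemma card_psi_identity : #|I0| = n.
Proof. by rewrite card_imset ?card_ord//; exact: lshift_inj. Qed.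

(** These [n] columns are the unit vectors, which span a space of dimension [n]. *)
Lemma free_psi_identity : free [seq v j | j <- enum I0].
Proof.
have sI : size [seq v j | j <- enum I0] = n.
  by rewrite size_map -cardE card_psi_identity.
suff full : (fullv <= <<[seq v j | j <- enum I0]>>)%VS.
  have := dimvS full; rewrite dimvf /dim /= muln1 => le.
  by rewrite /free eqn_leq dim_span sI.
apply/subvP => w _; rewrite (matrix_sum_delta w) memv_suml// => i _.
rewrite big_ord1 memvZ// memv_span// -col_psi_lshift map_f//.
by rewrite mem_enum imset_f.
Qed.

(** The unit vectors other than the [i]-th span the kernel of the [i]-th coordinate form. *)
Lemma span_psi_identityD1 (i : 'I_n) (w : 'cV[R]_n) :
  (w \in <<[seq v j | j <- enum (I0 :\ lshift n i)%SET]>>%VS) = (w i 0 == 0).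
Proof.
(* The coordinate form takes values in [R^o], that is, [R] as a vector space over itself. *)
pose f : 'cV[R]_n -> R^o := fun u => u i 0.
have flin : linear f by move=> a x y; rewrite /f !mxE.
pose fL : {linear 'cV[R]_n -> R^o} :=
  HB.pack f (GRing.isLinear.Build _ _ _ _ f flin).
apply/idP/eqP => [|wi0].
  suff sub : (<<[seq v j | j <- enum (I0 :\ lshift n i)%SET]>> <=
              lker (linfun fL))%VS.
    by move=> /(subvP sub); rewrite memv_ker lfunE => /eqP.
  apply/span_subvP => w' /mapP[j + ->] {w'}.
  rewrite mem_enum !inE => /andP[ji /imsetP[k _ ej]].
  rewrite memv_ker lfunE /= /f ej col_psi_lshift mxE eqxx andbT.
  by move: ji; rewrite ej (inj_eq (@lshift_inj _ _)) eq_sym => /negPf->.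
rewrite (matrix_sum_delta w) memv_suml// => k _; rewrite big_ord1.
have [->|ki] := eqVneq k i; first by rewrite wi0 scale0r mem0v.
rewrite memvZ// memv_span// -col_psi_lshift map_f// mem_enum !inE.
by rewrite (inj_eq (@lshift_inj _ _)) ki imset_f.
Qed.

(** Replacing a unit vector by another column keeps a basis iff the column is nonzero at that
    coordinate. As [psi] reverses the rows, coordinate [rev_ord i] of column [rshift n j] is [A i j]
    up to sign. *)
Lemma psi_entry_basis (i j : 'I_n) :
  let B := (rshift n j |: (I0 :\ lshift n (rev_ord i)))%SET in
  (#|B| = n /\ free [seq v k | k <- enum B]) <-> A i j != 0.
Proof.
move=> B; have rI : rshift n j \notin (I0 :\ lshift n (rev_ord i))%SET.
  rewrite !inE negb_and; apply/orP; right; apply/imsetP => -[k _ /eqP].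
  by rewrite eq_rlshift.
have iI : lshift n (rev_ord i) \in I0 by rewrite imset_f.
have cB : #|B| = n.
  rewrite cardsU1 rI -[RHS]card_psi_identity.
  by rewrite (cardsD1 (lshift n (rev_ord i)) I0) iI.
have fI := free_setD1 iI free_psi_identity.
rewrite free_setU1// fI andbT span_psi_identityD1 col_psi_rshift rev_ordK.
by rewrite mulf_eq0 signr_eq0; split=> [[]|].
Qed.

End Psi.

(** * Isomorphism and isomorphism classes *)

Section Isomorphism.
Variables (d d' d'' : Order.disp_t).

Lemma isomorphic_sym (P : finPOrderType d) (Q : finPOrderType d') :
  isomorphic P Q -> isomorphic Q P.
Proof.
move=> [f [[g fK gK] fm]]; exists g; split; first by exists f.
by move=> x y; rewrite -fm !gK.
Qed.

Lemma isomorphic_trans (P : finPOrderType d) (Q : finPOrderType d')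
    (S : finPOrderType d'') :
  isomorphic P Q -> isomorphic Q S -> isomorphic P S.
Proof.
move=> [f [fb fm]] [g [gb gm]]; exists (g \o f); split; first exact: bij_comp.
by move=> x y /=; rewrite gm fm.
Qed.

End Isomorphism.

Lemma iso_class_eq n d d' (P : finPOrderType d) (Q : finPOrderType d') :
  isomorphic P Q -> iso_class n P = iso_class n Q.
Proof.
move=> PQ; apply/seteqP; split=> S /=; apply: isomorphic_trans => //.
exact: isomorphic_sym.
Qed.

(** A copy of [P] on ['I_n] lies in the common class, so it is isomorphic to both [P] and [Q]. *)
Lemma iso_class_isomorphic n d d' (P : finPOrderType d) (Q : finPOrderType d') :
  #|P| = n -> iso_class n P = iso_class n Q -> isomorphic P Q.
Proof.
move=> cP ePQ.
pose ell (i : 'I_n) : P := enum_val (cast_ord (esym cP) i).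
pose ellV (x : P) : 'I_n := cast_ord cP (enum_rank x).
have ellK : cancel ell ellV by move=> i; rewrite /ellV enum_valK cast_ordKV.
have ellVK : cancel ellV ell by move=> x; rewrite /ell cast_ordK enum_rankK.
have lexx : reflexive (fun i j => ell i <= ell j)%O by move=> i; exact: lexx.
have lea : antisymmetric (fun i j => ell i <= ell j)%O.
  by move=> i j /le_anti /(can_inj ellK).
have letr : transitive (fun i j => ell i <= ell j)%O.
  by move=> i j k; exact: le_trans.
(* The order of [P] transported to ['I_n] along an enumeration. *)
pose S := OrdPoset lexx lea letr.
have PS : isomorphic P S.
  exists (ellV : P -> S); split; first by exists ell.
  by move=> x y; rewrite {1}/Order.le /= !ellVK.
have QS : isomorphic Q S by have : iso_class n P S by []; rewrite ePQ.
exact/(isomorphic_trans PS)/isomorphic_sym.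
Qed.

(** * Altitude and canonical labelings *)

Lemma isomorphic_altitude d d' (P : finPOrderType d) (Q : finPOrderType d')
    (f : P -> Q) :
  bijective f -> {mono f : x y / (x <= y)%O} ->
  forall x, altitude (f x) = altitude x.
Proof.
move=> fb fm x; rewrite /altitude.
rewrite -(on_card_preimset (f := f)); last exact: onW_bij.
rewrite -(on_card_preimset (f := f) (R := [set y | (f x <= y)%O]%SET));
  last exact: onW_bij.
by congr (Posz _ - Posz _); apply: eq_card => y; rewrite !inE fm.
Qed.

(** Listing the elements by weakly increasing altitude gives such a labeling. *)
Lemma canonical_labeling_exists n d (P : finPOrderType d) :
  #|P| = n -> exists ell : 'I_n -> P, canonical_labeling ell.
Proof.
move=> cP; pose r := relpre (@altitude _ P) <=%R.
have rt : total r by move=> x y; exact: le_total.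
have rr : reflexive r by move=> x; exact: lexx.
have rtr : transitive r by move=> x y z; exact: le_trans.
pose s := sort r (enum P).
have ss : size s == n by rewrite size_sort -cardE cP.
pose t := Tuple ss; exists (tnth t); split.
  apply: inj_card_bij; last by rewrite card_ord cP.
  by apply/tuple_uniqP; rewrite sort_uniq enum_uniq.
move=> i j; apply: contraTltn => ji; rewrite -leNgt.
(* The label [i] provides the default element that [nth] requires. *)
have x0 := tnth t i; rewrite !(tnth_nth x0).
apply: (@sorted_leq_nth _ r rtr rr x0 s) => //.
- exact: sort_sorted.
- by rewrite inE (eqP ss).
- by rewrite inE (eqP ss).
Qed.

(** Both sequences of altitudes are sorted, and each is a permutation of the other. *)
Lemma canonical_labeling_altitude n d (P : finPOrderType d)
    (ell ell' : 'I_n -> P) :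
  canonical_labeling ell -> canonical_labeling ell' ->
  forall i, altitude (ell i) = altitude (ell' i).
Proof.
pose alts (e : 'I_n -> P) := [seq altitude (e i) | i <- enum 'I_n].
have alts_sorted e : canonical_labeling e -> sorted <=%R (alts e).
  move=> [_ ce]; rewrite sorted_map.
  (* The contrapositive of canonicity: altitudes increase weakly with the label. *)
  apply: (@sub_sorted _ (fun i j : 'I_n => (i <= j)%N)).
    by move=> i j /=; rewrite leqNgt leNgt; apply: contra => /ce.
  have : sorted leq (map val (enum 'I_n)) by rewrite val_enum_ord iota_sorted.
  by rewrite sorted_map.
move=> cl cl' i.
have e_eq : alts ell = alts ell'.
  apply: (sorted_eq le_trans le_anti); [exact: alts_sorted..|].
  rewrite /alts (map_comp (@altitude _ P) ell) (map_comp (@altitude _ P) ell').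
  apply/perm_map/uniq_perm.
  - by rewrite map_inj_uniq ?enum_uniq//; apply: bij_inj cl.1.
  - by rewrite map_inj_uniq ?enum_uniq//; apply: bij_inj cl'.1.
  have [[[g _ gK] _] [[g' _ gK'] _]] := (cl, cl').
  move=> x; apply/mapP/mapP => _.
    by exists (g' x); rewrite ?mem_enum ?gK'.
  by exists (g x); rewrite ?mem_enum ?gK.
by move/eq_in_map: e_eq => /(_ i); apply; rewrite mem_enum.
Qed.

(** * Antiadjacency matrices of unit interval orders *)

Section UnitInterval.
Variables (R : realType) (d : Order.disp_t) (P : finPOrderType d).
Hypothesis uP : unit_interval_order P R.

(** The element [x] is counted once in each of the two weak sets, so it cancels. *)
Lemma altitude_strict (x : P) : altitude x =
  #|[set y : P | (y < x)%O]%SET|%:Z - #|[set y : P | (x < y)%O]%SET|%:Z.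
Proof.
have cD : #|[set y : P | (y <= x)%O]%SET| = #|[set y : P | (y < x)%O]%SET|.+1.
  rewrite (cardsD1 x) !inE lexx; congr _.+1.
  by apply: eq_card => y; rewrite !inE lt_neqAle.
have cU : #|[set y : P | (x <= y)%O]%SET| = #|[set y : P | (x < y)%O]%SET|.+1.
  rewrite (cardsD1 x) !inE lexx; congr _.+1.
  by apply: eq_card => y; rewrite !inE lt_neqAle eq_sym.
by rewrite /altitude cD cU; lia.
Qed.

(* As the intervals have equal length, strict down-sets grow and strict up-sets
   shrink as the interval moves to the right, so equal altitudes force both to
   coincide. *)
Lemma altitude_eq_lt (x y : P) : altitude x = altitude y ->
  forall z, ((x < z)%O = (y < z)%O) /\ ((z < x)%O = (z < y)%O).
Proof.
have [q [_ qP]] := uP.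
(* The claim is symmetric in [x] and [y]. *)
wlog xy : x y / q x <= q y => [wl exy z|].
  have [/wl/(_ exy)//|/ltW/wl/(_ (esym exy))/(_ z)[-> ->] //] := leP (q x) (q y).
have sD : [set z | (z < x)%O]%SET \subset [set z | (z < y)%O]%SET.
  apply/fintype.subsetP => z; rewrite !inE => /qP zx; apply/qP.
  exact: lt_le_trans zx xy.
have sU : [set z | (y < z)%O]%SET \subset [set z | (x < z)%O]%SET.
  apply/fintype.subsetP => z; rewrite !inE => /qP zx; apply/qP.
  by apply: le_lt_trans zx; rewrite lerD2r.
rewrite !altitude_strict.
pose D t := #|[set z : P | (z < t)%O]%SET|.
pose U t := #|[set z : P | (t < z)%O]%SET|.
rewrite -!/(D _) -!/(U _) => e.
have cD : (D x <= D y)%N := subset_leq_card sD.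
have cU : (U y <= U x)%N := subset_leq_card sU.
have eD : [set z | (z < x)%O]%SET = [set z | (z < y)%O]%SET.
  by apply/eqP; rewrite eqEcard sD -!/(D _); lia.
have eU : [set z | (y < z)%O]%SET = [set z | (x < z)%O]%SET.
  by apply/eqP; rewrite eqEcard sU -!/(U _); lia.
by move=> z; move/setP/(_ z): eD; move/setP/(_ z): eU; rewrite !inE.
Qed.

(** A label has the same altitude under both labelings, so [altitude_eq_lt] lets [ell' i] replace
    [ell i], and then [ell' j] replace [ell j], in each strict comparison. *)
Lemma antiadjacency_canonical n (ell ell' : 'I_n -> P) :
  canonical_labeling ell -> canonical_labeling ell' ->
  antiadjacency R ell = antiadjacency R ell'.
Proof.
move=> cl cl'; have e := canonical_labeling_altitude cl cl'.
apply/matrixP => i j; rewrite !mxE.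
by rewrite (altitude_eq_lt (e i) _).1 (altitude_eq_lt (e j) _).2.
Qed.

End UnitInterval.

(** * Existence, invariance, uniqueness and injectivity of the induced positroid *)

Section InducedPositroid.
Variables (R : realType) (n : nat).

Lemma induced_positroid_exists d (P : finPOrderType d) :
  #|P| = n -> exists M : matroid 'I_(n + n), induced_positroid R P M.
Proof.
move=> /canonical_labeling_exists[ell cl].
have [M MP] := vector_matroid (card_psi_identity n)
  (free_psi_identity (antiadjacency R ell)).
by exists M, ell.
Qed.

(** Composing a labeling with the isomorphism changes neither the altitudes nor the antiadjacency
    matrix. *)
Lemma induced_positroid_isomorphic d d' (P : finPOrderType d)
    (Q : finPOrderType d') M :
  isomorphic P Q -> induced_positroid R P M -> induced_positroid R (n := n) Q M.
Proof.
move=> [f [fb fm]] [ell [[eb ec] MP]]; exists (f \o ell); split; last first.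
  suff -> : antiadjacency R (f \o ell) = antiadjacency R ell by [].
  by apply/matrixP => i j; rewrite !mxE /= (leW_mono fm).
split; first exact: bij_comp.
by move=> i j /=; rewrite !(isomorphic_altitude fb fm); exact: ec.
Qed.

Lemma induced_positroid_unique d (P : finPOrderType d)
    (M M' : matroid 'I_(n + n)) :
  unit_interval_order P R ->
  induced_positroid R P M -> induced_positroid R P M' -> M = M'.
Proof.
move=> uP [ell [cl MP]] [ell' [cl' MP']]; apply: matroid_inj; apply/setP => B.
rewrite (antiadjacency_canonical uP cl cl') in MP.
by apply/idP/idP => [/MP/MP'|/MP'/MP].
Qed.

(** By [psi_entry_basis], [M] determines where each antiadjacency matrix vanishes, hence the strict
    order on labels; matching equal labels is then an isomorphism. *)
Lemma induced_positroid_inj d d' (P : finPOrderType d) (Q : finPOrderType d')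
    (M : matroid 'I_(n + n)) :
  induced_positroid R P M -> induced_positroid R Q M -> isomorphic P Q.
Proof.
move=> [e1 [[[g1 e1K g1K] _] MP]] [e2 [[[g2 e2K g2K] _] MQ]].
have entry i j : (antiadjacency R e1 i j != 0) = (antiadjacency R e2 i j != 0).
  by apply/idP/idP => /psi_entry_basis; [move/MP/MQ|move/MQ/MP];
    move/psi_entry_basis.
have elt i j : (e1 i < e1 j)%O = (e2 i < e2 j)%O.
  have := entry i j; rewrite !mxE.
  by do 2!case: ifP => //; rewrite ?eqxx ?oner_eq0.
exists (e2 \o g1); split.
  by apply: bij_comp; [exists g2 | exists e1].
move=> x y /=; rewrite !le_eqVlt -elt !g1K.
by rewrite (can_eq e2K) (can_eq g1K).
Qed.

End InducedPositroid.

(** * The bijection *)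

Theorem theorem5p4 (R : realType) (n : nat) :
  exists Phi : set (ord_poset n) -> matroid 'I_(n + n),
    (forall (d : Order.disp_t) (P : finPOrderType d) (M : matroid 'I_(n + n)),
       #|P| = n -> unit_interval_order P R ->
       (Phi (iso_class n P) = M <-> induced_positroid R P M)) /\
    set_bij (unit_interval_classes R n) (unit_interval_positroids R n) Phi.
Proof.
(* One matroid must serve all [n]-element posets of class [c]; these are isomorphic, so a matroid
   induced by one is induced by all. *)
have /choice[Phi PhiP] : forall c : set (ord_poset n),
    exists M : matroid 'I_(n + n), forall d (P : finPOrderType d),
      #|P| = n -> c = iso_class n P -> induced_positroid R P M.
  move=> c; have [[d [P [cP cE]]]|no] :=
      pselect (exists d (P : finPOrderType d), #|P| = n /\ c = iso_class n P).
    have [M MP] := induced_positroid_exists R cP; exists M => d' Q _ cQ.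
    apply: induced_positroid_isomorphic MP.
    by apply: iso_class_isomorphic cP _; rewrite -cE.
  (* A set that is the class of no [n]-element poset gets an arbitrary value, here the matroid of
     [psi 0]. *)
  have [M _] := vector_matroid (card_psi_identity n)
    (free_psi_identity (0 : 'M[R]_n)).
  by exists M => d P cP cE; case: no; exists d, P.
have PhiE d (P : finPOrderType d) M : #|P| = n -> unit_interval_order P R ->
    (Phi (iso_class n P) = M <-> induced_positroid R P M).
  move=> cP uP; have PP := PhiP _ d P cP erefl; split=> [<-//|].
  exact: induced_positroid_unique uP PP.
exists Phi; split => //; split.
- by move=> _ [d [P [cP uP ->]]]; exists d, P; split => //; apply: PhiP.
(* Injectivity: by [e], both posets induce the same matroid. *)
- move=> c c' /set_mem[d [P [cP uP ->]]] /set_mem[d' [Q [cQ uQ ->]]] e.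
  apply: iso_class_eq.
  apply: (@induced_positroid_inj R n _ _ _ _ (Phi (iso_class n P))).
    exact: PhiP.
  by rewrite e; exact: PhiP.
- move=> M [d [P [cP uP MP]]]; exists (iso_class n P); first by exists d, P.
  exact/PhiE.
Qed.
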